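(* Let $G$ be a profinite group having countably many (closed) subgroups $G_1, G_2, \ldots$, each of finite rank, whose union contains all commutators $[x,y]$ with $x,y\in G$. Then $G'$ is of finite rank.
   Context: For profinite groups all usual group-theoretic concepts are interpreted topologically: subgroups are closed, generation means topological generation, and $G'$ is the closed subgroup of $G$ generated by all commutators $[x,y]$, $x,y\in G$. A group is said to be of finite rank $r$ if every finitely generated subgroup of it can be generated by $r$ elements; it is of finite rank if this holds for some positive integer $r$ (which may depend on the subgroup $G_i$ in question). *)

(* Defs.v *)
From HB Require Import structures.
From mathcomp Require Import all_boot monoid.
From mathcomp Require Import all_classical topology.

Set Implicit Arguments.
Unset Strict Implicit.
Unset Printing Implicit Defensive.

Import Algebra.

Local Open Scope classical_set_scope.
Local Open Scope group_scope.

HB.structure Definition PreTopologicalGroup :=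
  {G of Topological G & Group G}.

HB.mixin Record PreTopologicalGroup_isTopologicalGroup G
    & PreTopologicalGroup G := {
  mulg_continuous : continuous (fun z : G * G => z.1 * z.2);
  invg_continuous : continuous (fun x : G => x^-1)
}.

#[short(type="topologicalGroupType")]
HB.structure Definition TopologicalGroup :=
  {G of PreTopologicalGroup G & PreTopologicalGroup_isTopologicalGroup G}.

Definition profinite (G : topologicalGroupType) : Prop :=
  [/\ compact [set: G], hausdorff_space G & totally_disconnected [set: G]].

Section ClosedSubgroups.
Variable G : topologicalGroupType.
Implicit Types (A H K : set G) (r : nat).

Definition closed_subgroup H : Prop :=
  [/\ closed H, H 1, forall x y, H x -> H y -> H (x * y)
    & forall x, H x -> H x^-1].

Definition topgen A : set G := smallest closed_subgroup A.

Definition derived_subgroup : set G :=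
  topgen [set z | exists x y : G, z = [~ x, y]].

Definition finitely_generated H : Prop :=
  exists2 A : set G, finite_set A & H = topgen A.

(* The entries of the tuple may repeat, so this means "by at most r
   elements". *)
Definition generated_by r H : Prop :=
  exists s : r.-tuple G, H = topgen [set` s].

(* H is meant to be a closed subgroup of G; the closed subgroups of H are then
   the closed subgroups of G contained in H, and generation inside H agrees
   with generation inside G. *)
Definition of_rank r H : Prop :=
  forall K, closed_subgroup K -> K `<=` H ->
    finitely_generated K -> generated_by r K.

Definition finite_rank H : Prop := exists2 r, (0 < r)%N & of_rank r H.

End ClosedSubgroups.

Arguments derived_subgroup : clear implicits.

(* Main.v *)
Require Import Defs.
From mathcomp Require Import all_boot monoid.
From mathcomp Require Import all_classical topology.

(* By Baire's theorem on G * G there are a, b and an open normal subgroup N such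
   that [~ a * x, b * y] lies in a single G_i for all x, y in N.  The closed
   subgroup L generated by these commutators is normalised by N, because
   conjugation by N permutes the cosets a N and b N; it therefore contains
   [~ x, b * y] = ([~ a, b * y] ^ x)^-1 * [~ a * x, b * y] and then all [~ x, y]
   with x, y in N.  So P := L `&` N has finite rank and N / P is abelian.

   Every closed subgroup between P and N is normalised by N, so P may be
   enlarged by any closed subgroup of finite rank of N.  A second use of Baire's
   theorem, for each of finitely many representatives t of G / N, shows that the
   commutators [~ t, x] with x in N lie in such an enlargement.  Hence we may
   assume that N / P is central in G / P.  As in Schur's theorem, if T is a
   finite set of representatives and if P is enlarged by the finitely many
   elements of N of the form u^-1 * (t * t') with u, t, t' in T, then T P is a
   closed subgroup, a finite extension of P, which contains all commutators. *)

Local Open Scope classical_set_scope.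
Local Open Scope group_scope.

Set Implicit Arguments.
Unset Strict Implicit.
Unset Printing Implicit Defensive.

Import Algebra.

(** * Compact Hausdorff spaces *)

(** The sets [K]&[B i] form a filter base; a cluster point of it in [K] lies in every closure. *)
Lemma compact_closed_cluster (T : topologicalType) (K : set T)
    (I : Type) (D : set I) (B : I -> set T) :
  compact K -> (exists i, D i) ->
  (forall i j, D i -> D j -> exists2 k, D k & B k `<=` B i `&` B j) ->
  (forall i, D i -> K `&` B i !=set0) ->
  K `&` \bigcap_(i in D) closure (B i) !=set0.
Proof.
move=> cK D0 DI DK; pose F := filter_from D (fun i => K `&` B i).
have FF : ProperFilter F.
  apply: filter_from_proper => //; apply: filter_from_filter => // i j Di Dj.
  have [k Dk kij] := DI i j Di Dj.
  by exists k => // x [Kx /kij[? ?]].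
have [|p [Kp Fp]] := cK F FF.
  by case: D0 => i Di; exists i => // x [].
exists p; split=> // i Di V Vp.
have [|x [[_ Bx] Vx]] := Fp (K `&` B i) V _ Vp; first by exists i.
by exists x.
Qed.

Section BasisBaire.
Variable T : topologicalType.
Hypotheses (cT : compact [set: T]) (hT : hausdorff_space T).

(** The intersection [Q] of all clopen sets around [x] is connected, so total disconnectedness
    reduces it to [x]; compactness then replaces [Q] by a single clopen set. *)
Lemma compact_clopen_nbhs (x : T) (W : set T) :
  totally_disconnected [set: T] -> nbhs x W ->
  exists C, [/\ clopen C, C x & C `<=` W].
Proof.
move=> tdT.
pose Q := \bigcap_(C in [set C | clopen C /\ C x]) C.
have sQ (U : set T) : open U -> Q `<=` U ->
    exists C, [/\ clopen C, C x & C `<=` U].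
  move=> oU QU; apply: contrapT => noC.
  have [||||p [nUp Qp]] := @compact_closed_cluster T (~` U) (set T)
      [set C | clopen C /\ C x] id.
  - by apply: (subclosed_compact _ cT) => //; exact: open_closedC.
  - by exists setT; split => //; exact: clopenT.
  - move=> C D [cC Cx] [cD Dx]; exists (C `&` D) => //.
    by split=> //; exact: clopenI.
  - move=> C [cC Cx]; apply: contrapT => /set0P/negP.
    rewrite negbK setIC => /eqP /disjoints_subset; rewrite setCK => CU.
    by apply: noC; exists C.
  apply: nUp; apply: QU => C cC; have := Qp C cC.
  by case: cC => -[_ /closure_id <-].
suff Qx : Q `<=` [set x].
  rewrite nbhsE /= => -[U [oU Ux] UW].
  have [|C [cC Cx CU]] := sQ U oU; first by move=> y /Qx ->.
  by exists C; split=> //; exact: subset_trans CU UW.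
have cQ : closed Q by apply: closed_bigI => C [[]].
have xQ : Q x by move=> C [].
rewrite -(tdT x I); apply: connected_component_max => //.
apply/connectedP => E [E0 EQ sE].
have [clEf clEt] : closed (E false) /\ closed (E true).
  have cE b : closure (E b) `<=` Q.
    rewrite [X in _ `<=` X](iffLR (closure_id _) cQ); apply: closureS.
    by rewrite EQ; case: b; [right|left].
  case: sE => s1 s2; split; rewrite closure_id eqEsubset; split;
    try exact: subset_closure.
  - move=> y Ey; have := cE _ _ Ey; rewrite EQ => -[//|Ey'].
    by have : set0 y by rewrite -s1.
  - move=> y Ey; have := cE _ _ Ey; rewrite EQ => -[Ey'|//].
    by have : set0 y by rewrite -s2.
wlog Ex : E E0 EQ sE clEf clEt / E false x.
  move=> H; have : Q x by [].
  rewrite EQ => -[|Ex]; first exact: H.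
  by apply: (H (E \o negb)) => //;
    [case => /=|rewrite EQ setUC|rewrite separatedC].
(* Normality separates the two closed pieces of [Q]. A clopen [C] around [x] inside [U]|[V] then has
   clopen trace on [U], so [Q] lies in [U] and misses the piece [E true]. *)
have [U [V [oU oV EU EV UV]]] : exists U V : set T,
  [/\ open U, open V, E false `<=` U, E true `<=` V & U `&` V = set0].
  have [] := compact_normal hT cT clEf (t := ~` E true).
    apply/set_nbhsP; exists (~` E true); split => //; first exact: closed_openC.
    by apply/disjoints_subset; exact: separated_disjoint.
  move=> B /set_nbhsP[U [oU EU UB]] cB.
  exists U, (~` closure B); split => //.
  - exact/closed_openC/closed_closure.
  - by move=> y Ey /cB.
  - by apply/disjoints_subset; rewrite setCK;
    exact: subset_trans (@subset_closure _ _).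
have [||C [[oC cC] Cx CUV]] := sQ (U `|` V).
- exact: openU.
- by rewrite EQ => y [/EU|/EV]; [left|right].
have CUE : C `&` U = C `&` ~` V.
  apply/seteqP; split=> y [Cy Uy]; split => //.
    by move=> Vy; have : set0 y by rewrite -UV.
  by have [] := CUV y Cy.
have [y Ey] := E0 true.
have : Q y by rewrite EQ; right.
move=> /(_ (C `&` U)) [].
  split; last by split => //; exact: EU.
  split; first exact: openI.
  by rewrite CUE; apply: closedI => //; exact: open_closedC.
move=> _ Uy; have : set0 y by rewrite -UV; split => //; exact: EV.
by [].
Qed.

(** If no [F n] has interior in [O], nested nonempty open sets can be chosen, the closure of each
    avoiding the next [F n]; compactness gives a point of [O] outside all [F n]. *)
Lemma compact_Baire (F : nat -> set T) (O : set T) :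
  open O -> O !=set0 -> (forall n, closed (F n)) -> O `<=` \bigcup_n F n ->
  exists n U, [/\ open U, U !=set0, U `<=` O & U `<=` F n].
Proof.
move=> oO O0 cF OF; apply: contrapT => noU.
pose ok U := [/\ open U, U !=set0 & U `<=` O].
have step n U : exists V, ok U -> ok V /\ closure V `<=` U `\` F n.
  have [[oU U0 UO]|] := pselect (ok U); last by exists set0.
  have [y [Uy Fy]] : U `\` F n !=set0.
    apply: contrapT => /set0P/negP; rewrite negbK => /eqP.
    rewrite setD_eq0 => UF.
    by apply: noU; exists n, U.
  have oD : open (U `\` F n) by apply: openI => //; exact: closed_openC.
  have := @compact_regular T y setT hT cT filterT (U `\` F n).
  move=> []; first by apply: open_nbhs_nbhs; split.
  move=> B; rewrite nbhsE /= => -[V [oV Vy] VB] cB.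
  have cV : closure V `<=` U `\` F n by exact: subset_trans (closureS VB) cB.
  exists V => _; split=> //; split=> //; first by exists y.
  by move=> z /subset_closure /cV [/UO].
have {step} [f fP] : exists f : nat -> set T -> set T, forall n U,
    ok U -> ok (f n U) /\ closure (f n U) `<=` U `\` F n.
  exists (fun n => projT1 (choice (step n))) => n.
  exact: projT2 (choice (step n)).
pose U := fix U n := if n is n'.+1 then f n' (U n') else O.
have Uok n : ok (U n) by elim: n => [|n IH]; [split|exact: (fP n _ IH).1].
have Umono m n : (m <= n)%N -> U n `<=` U m.
  elim: n => [|n IH]; first by rewrite leqn0 => /eqP ->.
  rewrite leq_eqVlt => /predU1P[-> //|/IH Unm].
  apply: subset_trans Unm => z /subset_closure.
  by case: (fP n _ (Uok n)) => _ /[apply] -[].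
have [||||p [_ Up]] := @compact_closed_cluster T setT nat setT U.
- exact: cT.
- by exists 0.
- move=> m n _ _; exists (maxn m n) => // z Uz.
  by split; apply: Umono Uz; [exact: leq_maxl|exact: leq_maxr].
- by move=> n _; rewrite setTI; case: (Uok n).
(* Index 1 is used because [Up 0] would only place [p] in the closure of [O]. *)
have Op : O p.
  have /= := Up 1%N I.
  by case: (fP 0%N _ (Uok 0%N)) => _ /[apply] -[].
have [n _ Fp] := OF p Op.
by have := Up n.+1 I; case: (fP n _ (Uok n)) => _ /[apply] -[].
Qed.

End BasisBaire.

Lemma hausdorff_setX (S T : topologicalType) :
  hausdorff_space S -> hausdorff_space T -> hausdorff_space (S * T)%type.
Proof.
move=> hS hT [a b] [c d] cl; congr pair.
  apply: hS => A B Aa Bc.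
  have [||[x y] [/= Ax Bx]] := cl (fst @^-1` A) (fst @^-1` B); last by exists x.
  - exact: (cvg_fst Aa).
  - exact: (cvg_fst Bc).
apply: hT => A B Ab Bd.
have [||[x y] [/= Ay By]] := cl (snd @^-1` A) (snd @^-1` B); last by exists y.
- exact: (cvg_snd Ab).
- exact: (cvg_snd Bd).
Qed.


(** * Profinite groups *)

Section TopologicalGroupTheory.
Variable G : topologicalGroupType.
Implicit Types (A B H K N : set G) (x y g : G).

Lemma continuousMg (T : topologicalType) (f h : T -> G) :
  continuous f -> continuous h -> continuous (fun t => f t * h t).
Proof.
move=> cf ch t; apply: (@continuous_comp _ _ _ (fun t => (f t, h t))
  (fun z : G * G => z.1 * z.2)); last exact: mulg_continuous.
by apply: cvg_pair; [exact: cf|exact: ch].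
Qed.

Lemma continuousVg (T : topologicalType) (f : T -> G) :
  continuous f -> continuous (fun t => (f t)^-1).
Proof.
by move=> cf t; apply: continuous_comp; [exact: cf|exact: invg_continuous].
Qed.

Lemma continuousJg (T : topologicalType) (f h : T -> G) :
  continuous f -> continuous h -> continuous (fun t => f t ^ h t).
Proof.
move=> cf ch; apply: continuousMg; first exact: continuousVg.
exact: continuousMg.
Qed.

Lemma continuousRg (T : topologicalType) (f h : T -> G) :
  continuous f -> continuous h -> continuous (fun t => [~ f t, h t]).
Proof.
move=> cf ch; apply: continuousMg; first exact: continuousVg.
exact: continuousJg.
Qed.

Lemma closed_subgroup_closed H : closed_subgroup H -> closed H.
Proof. by case. Qed.

Lemma closed_subgroup1 H : closed_subgroup H -> H 1.
Proof. by case. Qed.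

Lemma closed_subgroupM H x y : closed_subgroup H -> H x -> H y -> H (x * y).
Proof. by case=> _ _ HM _; exact: HM. Qed.

Lemma closed_subgroupV H x : closed_subgroup H -> H x -> H x^-1.
Proof. by case=> _ _ _; apply. Qed.

Lemma closed_subgroupVM H x y :
  closed_subgroup H -> H x -> H (x^-1 * y) -> H y.
Proof.
by move=> sH Hx Hy; rewrite -(mulVKg x y); exact: closed_subgroupM.
Qed.

Lemma closed_subgroupI H K :
  closed_subgroup H -> closed_subgroup K -> closed_subgroup (H `&` K).
Proof.
move=> [cH H1 HM HV] [cK K1 KM KV]; split=> //; first exact: closedI.
- by move=> x y [? ?] [? ?]; split; [exact: HM|exact: KM].
- by move=> x [? ?]; split; [exact: HV|exact: KV].
Qed.

Lemma closed_subgroup_preimJ H g :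
  closed_subgroup H -> closed_subgroup [set x | H (x ^ g)].
Proof.
move=> [cH H1 HM HV]; split=> /=.
- apply: (@preimage_closed _ _ (fun x : G => x ^ g)) => //.
  move=> x _; move: x.
  by apply: continuousJg => ?; [exact: cvg_id|exact: cvg_cst].
- by rewrite conj1g.
- by move=> x y Hx Hy; rewrite conjMg; exact: HM.
- by move=> x Hx; rewrite conjVg; exact: HV.
Qed.

Lemma topgen_closed_subgroup A : closed_subgroup (topgen A).
Proof.
split.
- by apply: closed_bigI => B [[]].
- by move=> B [[]].
- by move=> x y Ax Ay B AB; case: (AB) => sB _;
    apply: closed_subgroupM; [|exact: Ax|exact: Ay].
- by move=> x Ax B AB; case: (AB) => sB _;
    apply: closed_subgroupV; [|exact: Ax].
Qed.

Lemma sub_topgen A : A `<=` topgen A.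
Proof. exact: sub_smallest. Qed.

Lemma topgen_sub A H : closed_subgroup H -> A `<=` H -> topgen A `<=` H.
Proof. exact: smallest_sub. Qed.

Lemma topgenJ A g :
  (forall x, A x -> A (x ^ g)) -> forall x, topgen A x -> topgen A (x ^ g).
Proof.
move=> AJ; apply: topgen_sub => [|x /AJ]; last exact: sub_topgen.
exact/closed_subgroup_preimJ/topgen_closed_subgroup.
Qed.

Lemma nbhs_lcoset A g : nbhs 1 A -> nbhs g [set x | A (g^-1 * x)].
Proof.
move=> A1; have cg : continuous (fun x : G => g^-1 * x).
  by apply: continuousMg => ?; [exact: cvg_cst|exact: cvg_id].
by apply: (cg g); rewrite mulVg.
Qed.

(** If [x] is in the closure of [H], the coset [x H] is a neighbourhood of [x] and hence meets
    [H]. *)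
Lemma nbhs1_closed_subgroup H : nbhs 1 H ->
  (forall x y, H x -> H y -> H (x * y)) ->
  (forall x, H x -> H x^-1) -> closed_subgroup H.
Proof.
move=> H1 HM HV; split=> //; last exact: nbhs_singleton.
move=> x /(_ _ (nbhs_lcoset x H1)) [y [Hy Hxy]].
by rewrite -(mulVKg y x); apply: HM => //; rewrite -(invgK x) -invgM; exact: HV.
Qed.

Definition open_normal N :=
  [/\ closed_subgroup N, nbhs 1 N & forall x g, N x -> N (x ^ g)].

Lemma nbhs1_lcoset A g : nbhs g A -> nbhs 1 [set x | A (g * x)].
Proof.
move=> Ag; have cg : continuous (fun x : G => g * x).
  by apply: continuousMg => ?; [exact: cvg_cst|exact: cvg_id].
by apply: (cg 1); rewrite mulg1.
Qed.

Lemma open_normal_open N : open_normal N -> open N.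
Proof.
move=> [sN N1 _]; rewrite openE => x Nx.
by apply: filterS (nbhs_lcoset x N1) => y; exact: closed_subgroupVM.
Qed.

(** * Open normal subgroups and products of closed subgroups *)

Section Profinite.
Hypothesis hG : profinite G.

Lemma profinite_open_normal_nbhs A :
  nbhs 1 A -> exists2 N, open_normal N & N `<=` A.
Proof.
case: hG => cG haus tdG A1.
have [C [[oC cC] C1 CA]] := compact_clopen_nbhs cG haus tdG A1.
(* The stabiliser of [C] under right translation; it is a neighbourhood of 1 because [C] is compact
   and open. *)
pose V := [set x | forall c, C c -> C (c * x) /\ C (c * x^-1)].
have V1 : nbhs 1 V.
  have := subclosed_compact cC cG (fun _ _ => I).
  move=> /compact_near_coveringP.
  move=> /(_ G (nbhs 1) (fun x c => C (c * x) /\ C (c * x^-1))).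
  apply => c Cc.
  have c1 : continuous (fun z : G * G => z.1 * z.2) by exact: mulg_continuous.
  have c2 : continuous (fun z : G * G => z.1 * z.2^-1).
    apply: continuousMg; first by move=> ?; exact: cvg_fst.
    by apply: continuousVg; by move=> ?; exact: cvg_snd.
  apply: filterI.
    apply: (c1 (c, 1)); rewrite /= mulg1; exact: open_nbhs_nbhs.
  by apply: (c2 (c, 1)); rewrite /= invg1 mulg1; exact: open_nbhs_nbhs.
have VM x y : V x -> V y -> V (x * y).
  move=> Vx Vy c Cc; split.
    by rewrite mulgA; apply: (Vy _ _).1; apply: (Vx _ _).1.
  by rewrite invgM mulgA; apply: (Vx _ _).2; apply: (Vy _ _).2.
have VV x : V x -> V x^-1 by move=> Vx c /Vx[? ?]; rewrite invgK.
(* The normal core of [V], again a neighbourhood of 1, now by compactness of [G]. *)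
pose N := [set x | forall g, V (x ^ g)].
have N1 : nbhs 1 N.
  move/compact_near_coveringP : cG.
  move=> /(_ G (nbhs 1) (fun x g => V (x ^ g))) H.
  have : \forall x \near nbhs 1, [set: G] `<=` (fun g => V (x ^ g)).
    apply: H => g _.
    have c3 : continuous (fun z : G * G => z.2 ^ z.1).
      by apply: continuousJg => ?; [exact: cvg_snd|exact: cvg_fst].
    by apply: (c3 (g, 1)); rewrite /= conj1g.
  by apply: filterS => x Nx g; exact: Nx.
have NM x y : N x -> N y -> N (x * y).
  by move=> Nx Ny g; rewrite conjMg; exact: VM.
have NV x : N x -> N x^-1 by move=> Nx g; rewrite conjVg; exact: VV.
exists N.
  split=> //; last by move=> x g Nx h; rewrite -conjgM.
  exact: nbhs1_closed_subgroup.
move=> x /(_ 1); rewrite conjg1 => /(_ _ C1)[+ _].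
by rewrite mul1g => /CA.
Qed.

(** The open cosets of [N] cover the compact group [G]. The near-covering form of compactness is
    applied to the filter of finite lists directed by inclusion. *)
Lemma open_normal_transversal N : open_normal N ->
  exists s : seq G, forall g, exists2 t, t \in s & N (t^-1 * g).
Proof.
case: hG => cG _ _ [sN N1 _].
pose F : set_system (seq G) :=
  filter_from [set: seq G] (fun s => [set s' : seq G | {subset s <= s'}]).
have FF : ProperFilter F.
  apply: filter_from_proper => [|s _]; last by exists s => x.
  apply: filter_from_filter; first by exists [::].
  move=> s1 s2 _ _; exists (s1 ++ s2) => // s ss; split=> x xs; apply: ss;
    by rewrite mem_cat xs ?orbT.
move/compact_near_coveringP : cG.
move=> /(_ (seq G) F (fun s g => exists2 t, t \in s & N (t^-1 * g))) [].
  move=> g _; exists ([set x | N (g^-1 * x)], [set s | g \in s]) => /=.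
    split; first exact: nbhs_lcoset.
    by exists [:: g] => // s /(_ g); apply; rewrite inE.
  by move=> [x s] /= [Nx gs]; exists g.
by move=> s _ /(_ s) Hs; exists s => g; apply: Hs.
Qed.

Definition mulset A B := [set x * y | x in A & y in B].

Lemma mulset_closed A B : closed A -> closed B -> closed (mulset A B).
Proof.
case: hG => cG haus _ cA cB.
have -> : mulset A B = (fun z : G * G => z.1 * z.2) @` (A `*` B).
  apply/seteqP; split=> z.
    by move=> [x Ax [y By <-]]; exists (x, y).
  by move=> [[x y] /= [Ax By] <-]; exists x => //; exists y.
apply: compact_closed => //; apply: continuous_compact.
  by apply: continuous_subspaceT; exact: mulg_continuous.
by apply: compact_setX; apply: subclosed_compact cG _.
Qed.

Lemma mulset_closed_subgroup A B : closed_subgroup A -> closed_subgroup B ->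
  (forall a b, A a -> B b -> A (a ^ b)) -> closed_subgroup (mulset A B).
Proof.
move=> sA sB AB; split.
- by apply: mulset_closed; exact: closed_subgroup_closed.
- exists 1; first exact: closed_subgroup1.
  by exists 1; [exact: closed_subgroup1|rewrite mulg1].
- move=> _ _ [a Aa [b Bb <-]] [a' Aa' [b' Bb' <-]].
  exists (a * a' ^ b^-1).
    by apply: closed_subgroupM => //; apply: AB => //; exact: closed_subgroupV.
  exists (b * b'); first exact: closed_subgroupM.
  by rewrite conjgE invgK !gnorm.
- move=> _ [a Aa [b Bb <-]]; exists (a^-1 ^ b).
    by apply: AB => //; exact: closed_subgroupV.
  exists b^-1; first exact: closed_subgroupV.
  by rewrite conjgE !gnorm.
Qed.

Lemma sub_mulsetl A B : closed_subgroup B -> A `<=` mulset A B.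
Proof.
move=> sB a Aa; exists a => //; exists 1; last by rewrite mulg1.
exact: closed_subgroup1.
Qed.

Lemma sub_mulsetr A B : closed_subgroup A -> B `<=` mulset A B.
Proof.
move=> sA b Bb; exists 1; first exact: closed_subgroup1.
by exists b; [|rewrite mul1g].
Qed.

(** If [x] is outside [H], some coset [x U] avoids [H]; but [x = h * u] puts [h = x * u^-1] in
    both. *)
Lemma closed_subgroup_eqmod H x : closed_subgroup H ->
  (forall U, open_normal U -> mulset H U x) -> H x.
Proof.
move=> sH HU; apply: contrapT => nHx.
have : nbhs x (~` H).
  apply: open_nbhs_nbhs; split=> //.
  by apply: closed_openC; exact: closed_subgroup_closed.
move=> /nbhs1_lcoset /profinite_open_normal_nbhs[U oU UH].
have [h Hh [u Uu hux]] := HU U oU.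
have : U u^-1 by apply: closed_subgroupV => //; case: oU.
by move=> /UH /=; rewrite -hux mulgK; apply.
Qed.

End Profinite.
End TopologicalGroupTheory.

(** * Finite rank *)

Lemma ultra_fmap_cvg (I : Type) (T : topologicalType) (F : set_system I)
    (f : I -> T) (K : set T) :
  UltraFilter F -> compact K -> F (f @^-1` K) ->
  exists2 p, K p & f @ F --> p.
Proof.
move=> FU cK FK; have [p [Kp clp]] := cK (f @ F) _ FK.
exists p => // A Ap; have [//|FA] := in_ultra_setVsetC (f @^-1` A) FU.
by have [y []] := clp (~` A) A FA Ap.
Qed.

Section Rank.
Variable G : topologicalGroupType.
Hypothesis hG : profinite G.
Implicit Types (A B H K N : set G) (c g x y : G) (r : nat).

Lemma generated_by_sub r K (s : r.-tuple G) : closed_subgroup K ->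
  [set` s] `<=` K -> K `<=` topgen [set` s] -> generated_by r K.
Proof.
by move=> sK sk Ks; exists s; apply/seteqP; split=> //; exact: topgen_sub.
Qed.

Lemma mulset_open_normal A N : closed_subgroup A -> open_normal N ->
  closed_subgroup (mulset A N).
Proof.
move=> sA [sN _ NJ].
have -> : mulset A N = mulset N A.
  apply/seteqP; split=> _ [a Aa [n Nn <-]].
    exists (n ^ a^-1); first exact: NJ.
    by exists a => //; rewrite conjgE invgK !gnorm.
  exists n => //; exists (a ^ n); first exact: NJ.
  by rewrite conjgE !gnorm.
by apply: mulset_closed_subgroup => // a b Na _; exact: NJ.
Qed.

(* The tuples found modulo the various U converge, along an ultrafilter tending
   to 1 on the open normal subgroups, to a tuple generating K. *)
Lemma generated_by_lift r K : closed_subgroup K ->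
  (forall U, open_normal U -> exists s : r.-tuple G,
     [set` s] `<=` K /\ K `<=` mulset (topgen [set` s]) U) ->
  generated_by r K.
Proof.
move=> sK genU.
have /choice[s sP] : forall U, exists s : r.-tuple G, open_normal U ->
    [set` s] `<=` K /\ K `<=` mulset (topgen [set` s]) U.
  move=> U; have [/genU[s ?]|nU] := pselect (open_normal U); first by exists s.
  by exists [tuple 1 | _ < r].
pose F :=
  filter_from (@open_normal G) (fun U => [set V | open_normal V /\ V `<=` U]).
have FF : ProperFilter F.
  apply: filter_from_proper => [|U oU]; last by exists U; split.
  apply: filter_from_filter => [|U V [sU U1 UJ] [sV V1 VJ]].
    have [U oU _] :=
      profinite_open_normal_nbhs hG (@filterT _ (nbhs (1 : G)) _).
    by exists U.
  exists (U `&` V).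
    split; first exact: closed_subgroupI.
      exact: filterI.
    by move=> x g [Ux Vx]; split; [exact: UJ|exact: VJ].
  by move=> W [oW WUV]; split; split => // x /WUV[].
have [F' [UF' FF']] := ultraFilterLemma FF.
have F'near U : open_normal U -> F' [set V | open_normal V /\ V `<=` U].
  by move=> oU; apply: FF'; exists U.
have [U0 oU0 _] := profinite_open_normal_nbhs hG (@filterT _ (nbhs (1 : G)) _).
have /choice[l lP] : forall i : 'I_r, exists p : G, K p /\
    (fun U => tnth (s U) i) @ F' --> p.
  move=> i; have cK : compact K.
    by case: hG => cG _ _; apply: subclosed_compact cG _ => //; case: sK.
  have [|p Kp sp] := ultra_fmap_cvg (f := fun U => tnth (s U) i) UF' cK.
    apply: filterS (F'near U0 oU0) => V [oV _] /=.
    by apply: (sP V oV).1; exact: mem_tnth.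
  by exists p.
have ltK : [set` [tuple l i | i < r]] `<=` K.
  by move=> x /= /tnthP[i ->]; rewrite tnth_mktuple; exact: (lP i).1.
apply: (generated_by_sub sK ltK) => k Kk.
apply: (closed_subgroup_eqmod hG); first exact: topgen_closed_subgroup.
move=> U oU; have [sU U1 UJ] := oU.
(* For small [V] the limits [l i] agree modulo [U] with the entries of [s V], which generate [K]
   modulo [V]. *)
have F'l : F' [set V | forall i, U ((l i)^-1 * tnth (s V) i)].
  apply: (@filter_forall _ _ (fun i V => U ((l i)^-1 * tnth (s V) i))) => i.
  exact: (lP i).2 _ (nbhs_lcoset (l i) U1).
have [V [[oV VU] Vl]] := filter_ex (filterI (F'near U oU) F'l).
set L := mulset _ U.
have sL : closed_subgroup L.
  by apply: mulset_open_normal => //; exact: topgen_closed_subgroup.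
have [w sw [v Vv <-]] := (sP V oV).2 k Kk.
apply: closed_subgroupM => //; last first.
  by apply: sub_mulsetr; [exact: topgen_closed_subgroup|exact: VU].
apply: topgen_sub sw => // x /= /tnthP[i ->].
exists (l i).
  by apply: sub_topgen => /=; apply/tnthP; exists i; rewrite tnth_mktuple.
by exists ((l i)^-1 * tnth (s V) i) => //; rewrite mulVKg.
Qed.

(** Modulo an open normal [U], [K] coincides with a finitely generated subgroup of itself, to which
    [of_rank] applies; [generated_by_lift] passes to the limit. *)
Lemma of_rankP r H K : of_rank r H -> closed_subgroup K -> K `<=` H ->
  generated_by r K.
Proof.
move=> rH sK KH; apply: generated_by_lift => // U oU.
have [T TP] := open_normal_transversal hG oU.
have [sU _ _] := oU.
(* [k t] is a point of [K] in the coset [t U], or 1 if there is none. *)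
have /choice[k kP] : forall t, exists k, K k /\
    ((exists2 y, K y & U (t^-1 * y)) -> U (t^-1 * k)).
  move=> t; have [[y Ky Uty]|nK] := pselect (exists2 y, K y & U (t^-1 * y)).
    by exists y.
  by exists 1; split => //; exact: closed_subgroup1.
have ksK : topgen [set` [seq k t | t <- T]] `<=` K.
  by apply: topgen_sub => // x /= /mapP[t _ ->]; exact: (kP t).1.
have [|||s es] := rH (topgen [set` [seq k t | t <- T]]).
- exact: topgen_closed_subgroup.
- exact: subset_trans ksK KH.
- by exists [set` [seq k t | t <- T]] => //; exact: finite_seq.
exists s; rewrite -es; split.
  by move=> x xs; apply: ksK; rewrite es; exact: sub_topgen.
move=> y Ky; have [t tT Uty] := TP y.
exists (k t); first by apply: sub_topgen; rewrite /= map_f.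
exists ((k t)^-1 * y); last by rewrite mulVKg.
have Utk : U (t^-1 * k t) := (kP t).2 (ex_intro2 _ _ y Ky Uty).
have -> : (k t)^-1 * y = (t^-1 * k t)^-1 * (t^-1 * y) by rewrite !gnorm.
by apply: closed_subgroupM => //; exact: closed_subgroupV.
Qed.

Definition hereditarily_generated r H :=
  forall K, closed_subgroup K -> K `<=` H -> generated_by r K.

Lemma finite_rankP H : finite_rank H <-> exists r, hereditarily_generated r H.
Proof.
split=> [[r _ rH]|[r rH]]; first by exists r => K; exact: of_rankP.
(* The successor ensures a positive bound; the tuple is padded with 1. *)
exists r.+1 => // K sK KH _; have [s sk] := rH K sK KH.
exists [tuple of 1 :: s]; rewrite sk.
apply/seteqP; split; apply: topgen_sub; try exact: topgen_closed_subgroup.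
  by move=> x xs; apply: sub_topgen; rewrite /= inE [x \in s]xs orbT.
move=> x /=; rewrite inE => /predU1P[->|]; last exact: sub_topgen.
by apply: closed_subgroup1; exact: topgen_closed_subgroup.
Qed.

(** * Permanence properties of finite rank *)

Lemma finite_rank_sub H K : finite_rank K -> H `<=` K -> finite_rank H.
Proof.
move=> [r r0 rK] HK; exists r => // L sL LH; apply: rK => //.
exact: subset_trans HK.
Qed.

(** Ranks add along an extension: [K] is generated by generators of [K]&[A] and lifts of generators
    of its image modulo [A]. That image is handled without quotients, through the subgroup
    [mulset A K]&[B] of [B]. *)
Lemma finite_rank_mulset A B : closed_subgroup A -> closed_subgroup B ->
  (forall a b, A a -> B b -> A (a ^ b)) ->
  finite_rank A -> finite_rank B -> finite_rank (mulset A B).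
Proof.
move=> sA sB AB /finite_rankP[r1 rA] /finite_rankP[r2 rB].
have sAB : closed_subgroup (mulset A B) by exact: mulset_closed_subgroup.
apply/finite_rankP; exists (r1 + r2)%N => K sK KAB.
have AK a k : A a -> K k -> A (a ^ k).
  move=> Aa /KAB[a' Aa' [b Bb <-]]; rewrite conjgM; apply: AB => //.
  apply: closed_subgroupM => //; first exact: closed_subgroupV.
  exact: closed_subgroupM.
have sAK : closed_subgroup (mulset A K) by exact: mulset_closed_subgroup.
have [s1 e1] : generated_by r1 (K `&` A).
  by apply: rA => [|x []//]; exact: closed_subgroupI.
have [s2 e2] : generated_by r2 (mulset A K `&` B).
  by apply: rB => [|x []//]; exact: closed_subgroupI.
have /choice[k kP] : forall x, exists k, mulset A K x -> K k /\ A (x * k^-1).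
  move=> x; have [[a Aa [k Kk <-]]|nx] := pselect (mulset A K x).
    by exists k; rewrite mulgK.
  by exists 1.
have s2P x : x \in s2 -> mulset A K x.
  move=> xs; suff : (mulset A K `&` B) x by case.
  by rewrite e2; exact: sub_topgen.
apply: (@generated_by_sub _ _ (cat_tuple s1 (map_tuple k s2))) => //.
  move=> x /=; rewrite mem_cat => /orP[xs|/mapP[y ys ->]].
    suff : (K `&` A) x by case.
    by rewrite e1; exact: sub_topgen.
  exact: (kP y (s2P y ys)).1.
set J := topgen _.
have sJ : closed_subgroup J by exact: topgen_closed_subgroup.
have JK : J `<=` K.
  apply: topgen_sub => // x /=; rewrite mem_cat => /orP[xs|/mapP[y ys ->]].
    suff : (K `&` A) x by case.
    by rewrite e1; exact: sub_topgen.
  exact: (kP y (s2P y ys)).1.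
have KAJ : K `&` A `<=` J.
  rewrite e1; apply: topgen_sub => // x xs; apply: sub_topgen.
  by rewrite /= mem_cat [x \in s1]xs.
have sAJ : closed_subgroup (mulset A J).
  by apply: mulset_closed_subgroup => // a j Aa /JK; exact: AK.
have BAJ : mulset A K `&` B `<=` mulset A J.
  rewrite e2; apply: topgen_sub => // x xs.
  have [_ Axk] := kP x (s2P x xs).
  exists (x * (k x)^-1) => //; exists (k x); last by rewrite mulgVK.
  by apply: sub_topgen; rewrite /= mem_cat map_f ?orbT.
(* Writing [x = a * b] and [b = a' * j] with [j] in [J], the element [x * j^-1 = a * a'] lies in
   [K]&[A], hence in [J]. *)
move=> x Kx; have [a Aa [b Bb abx]] := KAB x Kx.
have [a' Aa' [j Jj ajb]] : mulset A J b.
  apply: BAJ; split=> //; exists a^-1; first exact: closed_subgroupV.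
  by exists x => //; rewrite -abx mulKg.
rewrite -(mulgVK j x). apply: (@closed_subgroupM _ J) => //. apply: KAJ; split.
  by apply: closed_subgroupM => //; apply: closed_subgroupV => //; exact: JK.
by rewrite -abx -ajb mulgA mulgK; exact: closed_subgroupM.
Qed.

(** To generators of [K]&[A] one adds a representative in [K] of each of the finitely many cosets
    [A t] that meet [K]. *)
Lemma finite_rank_extend A H (T : seq G) : closed_subgroup A ->
  finite_rank A -> (forall h, H h -> exists2 t, t \in T & A (h * t^-1)) ->
  finite_rank H.
Proof.
move=> sA /finite_rankP[r rA] HT; apply/finite_rankP.
exists (r + size T)%N => K sK KH.
have [s es] : generated_by r (K `&` A).
  by apply: rA => [|x []//]; exact: closed_subgroupI.
have /choice[k kP] : forall t, exists k, K k /\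
    ((exists2 y, K y & A (y * t^-1)) -> A (k * t^-1)).
  move=> t; have [[y Ky Aty]|nK] := pselect (exists2 y, K y & A (y * t^-1)).
    by exists y.
  by exists 1; split => //; exact: closed_subgroup1.
apply: (@generated_by_sub _ _ (cat_tuple s (map_tuple k (in_tuple T)))) => //.
  move=> x /=; rewrite mem_cat => /orP[xs|/mapP[t _ ->]].
    suff : (K `&` A) x by case.
    by rewrite es; exact: sub_topgen.
  exact: (kP t).1.
set J := topgen _.
have sJ : closed_subgroup J by exact: topgen_closed_subgroup.
have KAJ : K `&` A `<=` J.
  rewrite es; apply: topgen_sub => // x xs; apply: sub_topgen.
  by rewrite /= mem_cat [x \in s]xs.
move=> x Kx; have [t tT Axt] := HT x (KH x Kx).
have [Kk Akt] := kP t.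
rewrite -(mulgVK (k t) x); apply: (@closed_subgroupM _ J) => //; last first.
  by apply: sub_topgen; rewrite /= mem_cat map_f ?orbT.
apply: KAJ; split.
  by apply: closed_subgroupM => //; exact: closed_subgroupV.
have -> : x * (k t)^-1 = x * t^-1 * (k t * t^-1)^-1 by rewrite !gnorm.
apply: closed_subgroupM => //; apply: closed_subgroupV => //.
by apply: (kP t).2; exists x.
Qed.

Lemma commMgJ x y z : [~ x * y, z] = [~ x, z] ^ y * [~ y, z].
Proof. by rewrite !commgEl !conjgE !gnorm. Qed.

Lemma commgMJ x y z : [~ x, y * z] = [~ x, z] * [~ x, y] ^ z.
Proof. by rewrite !commgEl !conjgE !gnorm. Qed.

(** * Procyclic subgroups *)

Lemma open_normal_expg N c : open_normal N -> exists2 m, (0 < m)%N & N (c ^+ m).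
Proof.
move=> oN; have [sN _ _] := oN; have [s sP] := open_normal_transversal hG oN.
apply: contrapT => noexp.
have /choice[t tP] : forall n : nat, exists t, t \in s /\ N (t^-1 * c ^+ n).
  by move=> n; have [t] := sP (c ^+ n); exists t.
(* Pigeonhole: two powers of [c] in the same coset of [N] would have a positive power of [c] in [N]
   as their quotient. *)
have tinj : injective t.
  move=> m n; wlog mn : m n / (m < n)%N.
    by move=> H; case: (ltngtP m n) => // [/H//|/H H' /esym /H' ->].
  move=> tmn; exfalso; apply: noexp; exists (n - m)%N; first by
    rewrite subn_gt0.
  have -> : c ^+ (n - m) = ((t m)^-1 * c ^+ m)^-1 * ((t n)^-1 * c ^+ n).
    have -> : c ^+ n = c ^+ m * c ^+ (n - m) by rewrite -expgnDr subnKC // ltnW.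
    by rewrite tmn !gnorm.
  apply: closed_subgroupM => //; last exact: (tP n).2.
  by apply: closed_subgroupV => //; exact: (tP m).2.
have : (size (map t (iota 0 (size s).+1)) <= size s)%N.
  apply: uniq_leq_size; first by rewrite map_inj_uniq ?iota_uniq.
  by move=> _ /mapP[n _ ->]; exact: (tP n).1.
by rewrite size_map size_iota ltnn.
Qed.

Lemma closed_subgroupX H x n : closed_subgroup H -> H x -> H (x ^+ n).
Proof.
move=> sH Hx; elim: n => [|n IH]; first exact: closed_subgroup1.
by rewrite expgS; exact: closed_subgroupM.
Qed.

Lemma topgen1_eqmod N c x : open_normal N -> topgen [set c] x ->
  exists n, N ((c ^+ n)^-1 * x).
Proof.
move=> oN; have [sN N1 NJ] := oN; have [m m0 Nm] := open_normal_expg c oN.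
suff /topgen_sub : closed_subgroup [set x | exists n, N ((c ^+ n)^-1 * x)].
  by apply => _ ->; exists 1%N; rewrite expg1 mulVg; exact: closed_subgroup1.
apply: nbhs1_closed_subgroup.
- by apply: filterS N1 => y Ny; exists 0%N; rewrite expg0 invg1 mul1g.
- move=> y z [n Nn] [k Nk]; exists (n + k)%N.
  have -> : (c ^+ (n + k))^-1 * (y * z) =
      ((c ^+ n)^-1 * y) ^ (c ^+ k) * ((c ^+ k)^-1 * z).
    by rewrite expgnDr conjgE !gnorm.
  by apply: closed_subgroupM => //; exact: NJ.
(* Exponents are natural numbers; as [c ^+ m] is in [N], [n * m.-1] stands for [- n]. *)
- move=> y [n Nn]; exists (n * m.-1)%N.
  set u := (c ^+ n)^-1 * y in Nn.
  have -> : (c ^+ (n * m.-1))^-1 * y^-1 =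
      ((c ^+ m) ^+ n * u ^ (c ^+ (n * m.-1)))^-1.
    have -> : (c ^+ m) ^+ n = c ^+ n * c ^+ (n * m.-1).
      by rewrite -expgnA mulnC -expgnDr -mulnS prednK.
    by rewrite /u conjgE !gnorm.
  apply: closed_subgroupV => //; apply: closed_subgroupM => //.
    exact: closed_subgroupX.
  exact: NJ.
Qed.

(** As for subgroups of a cyclic group: modulo [U], the least positive power [c ^+ d] in [K U]
    generates [K], by division with remainder; one generator then lifts. *)
Lemma finite_rank_topgen1 c : finite_rank (topgen [set c]).
Proof.
apply/finite_rankP; exists 1%N => K sK Kc.
apply: generated_by_lift => // U oU; have [sU U1 UJ] := oU.
have sKU : closed_subgroup (mulset K U) by exact: mulset_open_normal.
have [m m0 Um] := open_normal_expg c oU.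
have exd : exists d, (0 < d)%N && `[< mulset K U (c ^+ d) >].
  by exists m; rewrite m0; apply/asboolP; exact: sub_mulsetr.
case: (ex_minnP exd) => d /andP[d0 /asboolP[k Kk [u Uu kud]]] dmin.
exists [tuple k]; split; first by move=> x /=; rewrite inE => /eqP ->.
move=> y Ky; have [n Un] := topgen1_eqmod oU (Kc y Ky).
have sL : closed_subgroup (mulset (topgen [set` [tuple k]]) U).
  by apply: mulset_open_normal => //; exact: topgen_closed_subgroup.
have KUn : mulset K U (c ^+ (n %% d)).
  have -> : c ^+ (n %% d) = ((c ^+ d) ^+ (n %/ d))^-1 * c ^+ n.
    by rewrite [in X in _ = _ * X](divn_eq n d) expgnDr mulnC expgnA mulKg.
  apply: closed_subgroupM => //.
    apply: closed_subgroupV => //; apply: closed_subgroupX => //.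
    by exists k => //; exists u.
  exists y => //; exists (y^-1 * c ^+ n); last by rewrite mulVKg.
  by rewrite -[y^-1 * _]invgK invgM invgK; exact: closed_subgroupV.
have dn : (d %| n)%N.
  apply: contrapT => /negP; rewrite /dvdn -lt0n => p0.
  have : (d <= n %% d)%N by apply: dmin; rewrite p0; exact/asboolP.
  by rewrite leqNgt ltn_mod d0.
rewrite -(mulVKg (c ^+ n) y); apply: closed_subgroupM => //; last first.
  by apply: sub_mulsetr => //; exact: topgen_closed_subgroup.
rewrite -(divnK dn) mulnC expgnA -kud; apply: closed_subgroupX => //.
exists k; last by exists u.
by apply: sub_topgen; rewrite /= inE.
Qed.

End Rank.

(** * Countable covers of the commutators *)

Section CountableCover.
Variable G : topologicalGroupType.
Hypothesis hG : profinite G.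
Implicit Types (A E H N P : set G) (a b c g t x y : G).

Lemma closed_subgroupR H x y : closed_subgroup H -> H x -> H y -> H [~ x, y].
Proof.
move=> sH Hx Hy; rewrite commgEl conjgE.
by do ![apply: closed_subgroupM => //]; apply: closed_subgroupV.
Qed.

Definition abelianizing N P :=
  [/\ closed_subgroup P, P `<=` N, forall x y, N x -> N y -> P [~ x, y]
    & finite_rank P].

(** [x ^ g = x * [~ x, g]], so [P] is normal in [N]. *)
Lemma abelianizingJ N P x g : abelianizing N P -> N g -> P x -> P (x ^ g).
Proof.
move=> [sP PN PR _] Ng Px; rewrite -(mulVKg x (x ^ g)) -commgEl.
by apply: closed_subgroupM => //; apply: PR => //; exact: PN.
Qed.

(** The product [P E] works: [E] normalises [P], and the commutators of [N] are already in [P]. *)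
Lemma abelianizing_mul N P E : closed_subgroup N -> abelianizing N P ->
  closed_subgroup E -> E `<=` N -> finite_rank E ->
  exists P', [/\ abelianizing N P', P `<=` P' & E `<=` P'].
Proof.
move=> sN aP sE EN rE; have [sP PN PR rP] := aP.
have PJ x y : P x -> E y -> P (x ^ y).
  by move=> Px /EN Ny; exact: (abelianizingJ aP).
exists (mulset P E); split; [split|exact: sub_mulsetl|exact: sub_mulsetr].
- exact: mulset_closed_subgroup.
- by move=> _ [x /PN Nx [y /EN Ny <-]]; exact: closed_subgroupM.
- by move=> x y Nx Ny; apply: sub_mulsetl => //; exact: PR.
- exact: finite_rank_mulset.
Qed.

Lemma abelianizing_adjoin N P (s : seq G) : closed_subgroup N ->
  abelianizing N P -> [set` s] `<=` N ->
  exists P', [/\ abelianizing N P', P `<=` P' & [set` s] `<=` P'].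
Proof.
move=> sN aP; elim: s => [|c s IH] csN; first by exists P; split.
have [|P1 [aP1 PP1 sP1]] := IH.
  by move=> x xs; apply: csN; rewrite /= inE [x \in s]xs orbT.
have [||P2 [aP2 P12 cP2]] :=
    abelianizing_mul sN aP1 (topgen_closed_subgroup [set c]).
- by apply: topgen_sub => // _ ->; apply: csN; rewrite /= mem_head.
- exact: finite_rank_topgen1.
exists P2; split=> //; first exact: subset_trans P12.
move=> x /=; rewrite inE => /predU1P[->|xs];
  first by apply: cP2; exact: sub_topgen.
by apply: P12; exact: sP1.
Qed.

Lemma abelianizing_of_cosets N H a b : open_normal N -> closed_subgroup H ->
  finite_rank H -> (forall x y, N x -> N y -> H [~ a * x, b * y]) ->
  exists P, abelianizing N P.
Proof.
move=> [sN _ NJ] sH rH Hab.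
pose L := topgen [set z | exists x y, [/\ N x, N y & z = [~ a * x, b * y]]].
have sL : closed_subgroup L by exact: topgen_closed_subgroup.
have LH : L `<=` H by apply: topgen_sub => // _ [x [y [Nx Ny ->]]]; exact: Hab.
have Lab x y : N x -> N y -> L [~ a * x, b * y].
  by move=> Nx Ny; apply: sub_topgen; exists x, y.
have LJ z g : N g -> L z -> L (z ^ g).
  move=> Ng; apply: topgenJ => {}z [x [y [Nx Ny ->]]].
  have NgJ c w : N w -> N (g^-1 ^ c * w * g).
    move=> Nw; apply: closed_subgroupM => //; apply: closed_subgroupM => //.
    by apply: NJ; exact: closed_subgroupV.
  (* Chosen so that [(a * x) ^ g = a * (g^-1 ^ a * x * g)], and likewise for [b]. *)
  exists (g^-1 ^ a * x * g), (g^-1 ^ b * y * g).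
  split; [exact: NgJ|exact: NgJ|].
  by rewrite conjRg; congr [~ _, _]; rewrite !conjgE !gnorm.
clearbody L; have L1 x y : N x -> N y -> L [~ x, b * y].
  move=> Nx Ny.
  have -> : [~ x, b * y] = ([~ a * 1, b * y] ^ x)^-1 * [~ a * x, b * y].
    by rewrite mulg1 commMgJ mulKg.
  apply: closed_subgroupM => //; last exact: Lab.
  apply: closed_subgroupV => //; apply: LJ => //; apply: Lab => //.
  exact: closed_subgroup1.
exists (L `&` N); split.
- exact: closed_subgroupI.
- by move=> x [].
- move=> x y Nx Ny; split; last exact: closed_subgroupR.
  have -> : [~ x, y] = [~ x, b * y] * ([~ x, b * 1] ^ y)^-1.
    by rewrite mulg1 commgMJ mulgK.
  apply: closed_subgroupM => //; first exact: L1.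
  apply: closed_subgroupV => //; apply: LJ => //; apply: L1 => //.
  exact: closed_subgroup1.
- by apply: finite_rank_sub rH _ => x [/LH].
Qed.

(** * Baire's theorem and reduction to a central quotient *)

Variable Gi : nat -> set G.
Hypotheses (hsub : forall i, closed_subgroup (Gi i))
  (hrank : forall i, finite_rank (Gi i))
  (hcomm : forall x y : G, (\bigcup_i Gi i) [~ x, y]).

Lemma exists_abelianizing :
  exists2 N, open_normal N & exists P, abelianizing N P.
Proof.
have [cG haus _] := hG.
have hausGG : hausdorff_space (G * G)%type by exact: hausdorff_setX.
have cGG : compact [set: (G * G)%type] by rewrite -setXTT; exact: compact_setX.
have cR : continuous (fun z : G * G => [~ z.1, z.2]).
  by apply: continuousRg => ?; [exact: cvg_fst|exact: cvg_snd].
have [||||i [U [oU [[a b] Uab] _ UF]]] := @compact_Baire (G * G)%type cGG hausGG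
    (fun i => [set z | Gi i [~ z.1, z.2]]) setT.
- exact: openT.
- by exists (1, 1).
- move=> i; apply: (@preimage_closed _ _ (fun z : G * G => [~ z.1, z.2])).
    by move=> x _; exact: cR.
  exact: closed_subgroup_closed.
- by move=> [x y] _; have [i _ ?] := hcomm x y; exists i.
have : nbhs (a, b) U by exact: open_nbhs_nbhs.
move=> [[A B] /= [/nbhs1_lcoset A1 /nbhs1_lcoset B1] AB].
have [N oN NAB] := profinite_open_normal_nbhs hG (filterI A1 B1).
exists N => //; apply: (@abelianizing_of_cosets _ (Gi i) a b) => // x y.
move=> /NAB[Ax _] /NAB[_ By].
exact: (UF (a * x, b * y) (AB (a * x, b * y) (conj Ax By))).
Qed.

(** Baire's theorem on [N] gives a coset [x0 V] whose commutators with [t] lie in one [Gi i].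
    Adjoining [Gi i]&[N] captures [[~ t, v]] for [v] in [V]; the finitely many cosets of [V] in [N]
    are then settled by adjoining [[~ t, y]] for representatives [y]. *)
Lemma abelianizing_comm1 N P t : open_normal N -> abelianizing N P ->
  exists P', [/\ abelianizing N P', P `<=` P' & forall x, N x -> P' [~ t, x]].
Proof.
have [cG haus _] := hG.
move=> oN aP; have [sN N1 NJ] := oN.
have cR : continuous (fun x : G => [~ t, x]).
  by apply: continuousRg => ?; [exact: cvg_cst|exact: cvg_id].
have [||||i [U [oU [x0 Ux0] UN UF]]] := @compact_Baire G cG haus
    (fun i => [set x | Gi i [~ t, x]]) N.
- exact: open_normal_open.
- by exists 1; exact: closed_subgroup1.
- move=> i; apply: (@preimage_closed _ _ (fun x : G => [~ t, x])).
    by move=> x _; exact: cR.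
  exact: closed_subgroup_closed.
- by move=> x _; have [i _ ?] := hcomm t x; exists i.
have [V oV VU] : exists2 V, open_normal V & V `<=` [set v | U (x0 * v)].
  apply: profinite_open_normal_nbhs => //.
  by apply: nbhs1_lcoset; exact: open_nbhs_nbhs.
have [sV V1 VJ] := oV; have Nx0 := UN _ Ux0.
have VN v : V v -> N v.
  move=> /VU /UN Nxv; rewrite -(mulKg x0 v); apply: closed_subgroupM => //.
  exact: closed_subgroupV.
have NR x : N x -> N [~ t, x].
  move=> Nx; rewrite commgEr; apply: closed_subgroupM => //.
  by apply: NJ; exact: closed_subgroupV.
have [||P1 [aP1 PP1 GP1]] :=
    abelianizing_mul sN aP (closed_subgroupI (hsub i) sN).
- by move=> x [].
- by apply: finite_rank_sub (hrank i) _ => x [].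
have sP1 : closed_subgroup P1 by case: aP1.
have P1V v : V v -> P1 [~ t, v].
  move=> Vv; rewrite -(conjgK x0 [~ t, v]).
  apply: (abelianizingJ aP1); first exact: closed_subgroupV.
  apply: GP1; split; last by apply/NJ/NR/VN.
  (* Since [x0 * v ^ x0 = v * x0], both factors on the right are commutators of [t] with points of
     [U], hence in [Gi i]. *)
  have -> : [~ t, v] ^ x0 = [~ t, x0]^-1 * [~ t, x0 * v ^ x0].
    by rewrite -conjgC commgMJ mulKg.
  apply: closed_subgroupM => //; last by apply: UF; apply: VU; exact: VJ.
  by apply: closed_subgroupV => //; exact: UF.
have [s sP] := open_normal_transversal hG oV.
have [|P2 [aP2 P12 sP2]] :=
    abelianizing_adjoin (s := [seq [~ t, y] | y <- s & `[< N y >]]) sN aP1.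
  move=> _ /mapP[y + ->]; rewrite mem_filter => /andP[/asboolP Ny _].
  exact: NR.
have sgP2 : closed_subgroup P2 by case: aP2.
exists P2; split=> //; first exact: subset_trans P12.
move=> x Nx; have [y ys Vyx] := sP x.
have Ny : N y.
  rewrite -(invgK y); apply: closed_subgroupV => //.
  by rewrite -(mulgK x y^-1); apply: closed_subgroupM;
    [|exact: VN|exact: closed_subgroupV].
have -> : x = (y^-1 * x) ^ y^-1 * y by rewrite conjgE !gnorm.
rewrite commgMJ; apply: closed_subgroupM => //.
  by apply: sP2; apply/mapP; exists y => //;
    rewrite mem_filter ys andbT; apply/asboolP.
by apply: (abelianizingJ aP2) => //; apply/P12/P1V; exact: VJ.
Qed.

(** Only representatives [t] of [G / N] matter: [[~ t * n, x] = [~ t, x] ^ n * [~ n, x]], with the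
    last factor in [P'] already. *)
Lemma abelianizing_comm N P : open_normal N -> abelianizing N P ->
  exists2 P', abelianizing N P' & forall g x, N x -> P' [~ g, x].
Proof.
move=> oN aP; have [s sP] := open_normal_transversal hG oN.
have [P' aP' tP'] : exists2 P', abelianizing N P' &
    forall t x, t \in s -> N x -> P' [~ t, x].
  elim: s {sP} => [|t s [P1 aP1 sP1]]; first by exists P.
  have [P2 [aP2 P12 tP2]] := abelianizing_comm1 t oN aP1.
  exists P2 => // u x; rewrite inE => /predU1P[->|us Nx]; first exact: tP2.
  by apply: P12; exact: sP1.
have [sP' PN' PR _] := aP'; exists P' => // g x Nx.
have [t ts Ntg] := sP g; rewrite -(mulVKg t g) commMgJ.
apply: closed_subgroupM => //; last exact: PR.
by apply: (abelianizingJ aP') => //; exact: tP'.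
Qed.

Lemma finite_rank_of_central N P : open_normal N -> abelianizing N P ->
  (forall g x, N x -> P [~ g, x]) -> finite_rank (derived_subgroup G).
Proof.
move=> oN aP PR; have [sN N1 NJ] := oN.
have [s0 s0P] := open_normal_transversal hG oN.
(* The entry 1 places [A] inside [W = s A], and the inverses make [W] stable under inversion. *)
pose s := 1 :: s0 ++ map (fun t => t^-1) s0.
pose cs := [seq c <-
    [seq u^-1 * w | u <- s, w <- [seq t * t' | t <- s, t' <- s]]
  | `[< N c >]].
have [|A [aA PA csA]] := abelianizing_adjoin (s := cs) sN aP.
  by move=> c /=; rewrite mem_filter => /andP[/asboolP].
have [sA AN _ rA] := aA.
(* Centrality of [N / P] makes [A] normal in all of [G], not only in [N]. *)
have AJ x g : A x -> A (x ^ g).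
  move=> Ax; rewrite -(mulVKg x (x ^ g)) -commgEl.
  apply: closed_subgroupM => //.
  by rewrite -invgR; apply: closed_subgroupV => //; apply/PA/PR/AN.
have [cG haus _] := hG.
pose W := mulset [set` s] A.
have sW : closed_subgroup W.
  split.
  - apply: mulset_closed => //; last exact: closed_subgroup_closed.
    apply: (accessible_finite_set_closed.1 (hausdorff_accessible haus)).
    exact: finite_seq.
  - exists 1; first by rewrite /= mem_head.
    by exists 1; rewrite ?mulg1 //; exact: closed_subgroup1.
  - move=> _ _ [t ts [x Ax <-]] [t' t's [x' Ax' <-]].
    (* [t * t' = u * c] with [c] in [cs], hence in [A]. *)
    have [u us Nu] := s0P (t * t').
    have us' : u \in s by rewrite inE mem_cat us orbT.
    exists u => //; exists (u^-1 * (t * t') * (x ^ t' * x')).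
      apply: closed_subgroupM => //; last first.
        by apply: closed_subgroupM => //; exact: AJ.
      apply: csA; rewrite /= mem_filter; apply/andP; split; first exact/asboolP.
      apply: (allpairs_f (fun u w => u^-1 * w)) => //.
      exact: (allpairs_f (fun t t' => t * t')).
    by rewrite conjgE !gnorm.
  - move=> _ [t ts [x Ax <-]].
    have ts' : t^-1 \in s.
      move: ts; rewrite /= !inE !mem_cat.
      move=> /predU1P[->|/orP[ts0|/mapP[u us ->]]].
      + by rewrite invg1 eqxx.
      + by rewrite map_f ?orbT.
      + by rewrite invgK us orbT.
    exists t^-1 => //; exists (x^-1 ^ t^-1).
      by apply: AJ; exact: closed_subgroupV.
    by rewrite conjgE !gnorm.
have AW : A `<=` W.
  by move=> x Ax; exists 1; [rewrite /= mem_head|exists x; rewrite ?mul1g].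
have rW : finite_rank W.
  apply: (finite_rank_extend hG (T := s) sA rA) => _ [t ts [x Ax <-]].
  exists t => //.
  have -> : t * x * t^-1 = x ^ t^-1 by rewrite conjgE invgK mulgA.
  exact: AJ.
apply: finite_rank_sub rW _; apply: topgen_sub => // _ [x [y ->]].
have WR g z : N z -> W [~ g, z] by move=> Nz; apply/AW/PA/PR.
have [t ts Ntx] := s0P x; have [t' ts' Nty] := s0P y.
have Ws u : u \in s0 -> W u.
  move=> us; exists u; first by rewrite /= inE mem_cat us orbT.
  by exists 1; rewrite ?mulg1 //; exact: closed_subgroup1.
clearbody W; have WJ w z : N z -> W w -> W (w ^ z).
  move=> Nz Ww; rewrite -(mulVKg w (w ^ z)) -commgEl.
  by apply: closed_subgroupM => //; exact: WR.
(* With [x = t * n] and [y = t' * n'], expanding leaves [[~ t, t']], which is in [W] since [t] and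
   [t'] are, and commutators with elements of [N], up to conjugation by [N]. *)
rewrite -(mulVKg t x) commMgJ; apply: closed_subgroupM => //.
  apply: (WJ) => //; rewrite -(mulVKg t' y) commgMJ.
  apply: closed_subgroupM => //; first exact: WR.
  by apply: WJ => //; apply: closed_subgroupR => //; exact: Ws.
by rewrite -invgR; apply: closed_subgroupV => //; exact: WR.
Qed.

End CountableCover.

Theorem theorem4p3 (G : topologicalGroupType) (hG : profinite G)
    (Gi : nat -> set G)
    (hsub : forall i, closed_subgroup (Gi i))
    (hrank : forall i, finite_rank (Gi i))
    (hcomm : forall x y : G, (\bigcup_i Gi i) [~ x, y]) :
  finite_rank (derived_subgroup G).
Proof.
have [N oN [P aP]] := exists_abelianizing hG hsub hrank hcomm.
have [P' aP' P'R] := abelianizing_comm hG hsub hrank hcomm oN aP.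
exact (finite_rank_of_central hG oN aP' P'R).
Qed.
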